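(* As formal power series in $q$ (equivalently, for all complex $q$ with $|q|<1$), $$\sum_{n,r\ge 0} \frac{q^{2n^2+3r^2+4nr}}{(-q;q)_{n+r}\,(-q;q)_{n+2r}\,(q;q)_n\,(q;q)_r} = \frac{(q^4,q^5,q^{9};q^{9})_\infty}{(q^2;q^2)_\infty}.$$
   Context: Notation: $(a;q)_m=\prod_{j=0}^{m-1}(1-aq^j)$ for integers $m\ge 0$, $(a;q)_\infty=\prod_{j=0}^{\infty}(1-aq^j)$, and $(a_1,\dots,a_s;q)_\infty=(a_1;q)_\infty\cdots(a_s;q)_\infty$; the base may be replaced by any power of $q$ (e.g. $(a;q^2)_m=\prod_{j=0}^{m-1}(1-aq^{2j})$). *)

(* Defs.v *)
From HB Require Import structures.
From mathcomp Require Import all_boot all_order all_algebra.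
From mathcomp Require Import boolp classical_sets filter topology.

Set Implicit Arguments.
Unset Strict Implicit.
Unset Printing Implicit Defensive.

Import GRing.Theory.

Local Open Scope ring_scope.

(* The ring R[[X]] of formal power series: Cauchy product, inverses of the    *)
(* series with invertible constant coefficient, and the X-adic topology.      *)

Record fps (R : Type) := Fps { fcoef : nat -> R }.

HB.instance Definition _ (R : Type) := [isNew for @fcoef R].
HB.instance Definition _ (R : choiceType) := [Choice of fps R by <:].

Lemma fpsP (R : Type) (f g : fps R) :
  (forall k, fcoef f k = fcoef g k) <-> f = g.
Proof.
split=> [|-> //]; case: f g => [f] [g] /= fg; congr Fps; exact: funext.
Qed.

Section FpsRing.
Variable R : comNzRingType.
Implicit Types f g h : fps R.

Definition fps_zero : fps R := Fps (fun=> 0).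
Definition fps_opp f := Fps (fun k => - fcoef f k).
Definition fps_add f g := Fps (fun k => fcoef f k + fcoef g k).
Definition fps_one : fps R := Fps (fun k => (k == 0)%:R).
Definition fps_mul f g :=
  Fps (fun k => \sum_(i < k.+1) fcoef f i * fcoef g (k - i)).

Fact fps_addA : associative fps_add.
Proof. by move=> f g h; apply/fpsP => k; rewrite /= addrA. Qed.
Fact fps_addC : commutative fps_add.
Proof. by move=> f g; apply/fpsP => k; rewrite /= addrC. Qed.
Fact fps_add0 : left_id fps_zero fps_add.
Proof. by move=> f; apply/fpsP => k; rewrite /= add0r. Qed.
Fact fps_addN : left_inverse fps_zero fps_opp fps_add.
Proof. by move=> f; apply/fpsP => k; rewrite /= addNr. Qed.

HB.instance Definition _ :=
  GRing.isZmodule.Build (fps R) fps_addA fps_addC fps_add0 fps_addN.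

Definition fps_trunc n f : {poly R} := \poly_(i < n) fcoef f i.

Lemma coef_fps_trunc n f k : (k < n)%N -> (fps_trunc n f)`_k = fcoef f k.
Proof. by move=> kn; rewrite coef_poly kn. Qed.

Lemma fps_mul_trunc n f g k : (k < n)%N ->
  fcoef (fps_mul f g) k = (fps_trunc n f * fps_trunc n g)`_k.
Proof.
move=> kn; rewrite coefM /=; apply: eq_bigr => i _.
rewrite !coef_fps_trunc //; first exact: leq_ltn_trans (leq_subr _ _) kn.
by apply: leq_ltn_trans kn; rewrite -ltnS.
Qed.

Fact fps_mulA : associative fps_mul.
Proof.
move=> f g h; apply/fpsP => k.
have kk : (k < k.+1)%N by [].
rewrite !(fps_mul_trunc _ _ kk).
transitivity ((fps_trunc k.+1 f * fps_trunc k.+1 g * fps_trunc k.+1 h)`_k).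
  rewrite -mulrA !coefM; apply: eq_bigr => i _; congr (_ * _).
  have ki : (k - i < k.+1)%N by rewrite ltnS leq_subr.
  by rewrite coef_fps_trunc // (fps_mul_trunc _ _ ki).
rewrite !coefM; apply: eq_bigr => i _; congr (_ * _).
by rewrite coef_fps_trunc // (fps_mul_trunc _ _ (ltn_ord i)).
Qed.
Fact fps_mulC : commutative fps_mul.
Proof.
move=> f g; apply/fpsP => k.
by rewrite !(fps_mul_trunc _ _ (ltnSn k)) mulrC.
Qed.
Fact fps_mul1 : left_id fps_one fps_mul.
Proof.
move=> f; apply/fpsP => k /=; rewrite big_ord_recl /= mul1r subn0.
by rewrite big1 ?addr0 // => i _; rewrite mul0r.
Qed.
Fact fps_mulDl : left_distributive fps_mul fps_add.
Proof.
move=> f g h; apply/fpsP => k /=; rewrite -big_split /=.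
by apply: eq_bigr => i _; rewrite mulrDl.
Qed.
Fact fps_one_neq0 : fps_one != 0 :> fps R.
Proof. by apply/eqP => /fpsP /(_ 0) /eqP; rewrite oner_eq0. Qed.

HB.instance Definition _ := GRing.Zmodule_isComNzRing.Build (fps R)
  fps_mulA fps_mulC fps_mul1 fps_mulDl fps_one_neq0.

Definition fpsX : fps R := Fps (fun k => (k == 1)%:R).

Lemma fcoef0 k : fcoef (0 : fps R) k = 0. Proof. by []. Qed.
Lemma fcoef1 k : fcoef (1 : fps R) k = (k == 0)%:R. Proof. by []. Qed.
Lemma fcoefN f k : fcoef (- f) k = - fcoef f k. Proof. by []. Qed.
Lemma fcoefD f g k : fcoef (f + g) k = fcoef f k + fcoef g k.
Proof. by []. Qed.
Lemma fcoefM f g k :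
  fcoef (f * g) k = \sum_(i < k.+1) fcoef f i * fcoef g (k - i).
Proof. by []. Qed.

Lemma fcoefX n k : fcoef (fpsX ^+ n) k = (k == n)%:R.
Proof.
elim: n k => [//|n IHn] k; rewrite exprS fcoefM.
case: k => [|k]; first by rewrite big_ord_recl big_ord0 mul0r addr0.
rewrite !big_ord_recl /= mul0r add0r mul1r IHn subSS subn0.
by rewrite big1 ?addr0 // => i _; rewrite mul0r.
Qed.

End FpsRing.

Section FpsUnitRing.
Variable R : comUnitRingType.
Implicit Types f g : fps R.

Definition fps_unit : {pred fps R} := fun f => fcoef f 0 \is a GRing.unit.

(* The n-th coefficient of f^-1 is obtained from the previous ones by         *)
(* solving (f * f^-1)_n = [n = 0].                                            *)
Fixpoint fps_inv_seq f n : seq R :=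
  if n is m.+1 then
    let s := fps_inv_seq f m in
    rcons s ((fcoef f 0)^-1 *
             ((m == 0)%:R - \sum_(i < m) fcoef f (m - i) * s`_i))
  else [::].

Definition fps_inv f : fps R :=
  if f \in fps_unit then Fps (fun k => (fps_inv_seq f k.+1)`_k) else f.

Lemma size_fps_inv_seq f n : size (fps_inv_seq f n) = n.
Proof. by elim: n => //= n IHn; rewrite size_rcons IHn. Qed.

Lemma nth_fps_inv_seq f m n k : (k < n)%N -> (n <= m)%N ->
  (fps_inv_seq f m)`_k = (fps_inv_seq f n)`_k.
Proof.
move=> kn; elim: m => [|m IHm]; first by rewrite leqn0 => /eqP n0; rewrite n0 in kn.
rewrite leq_eqVlt => /predU1P[-> //|]; rewrite ltnS => nm.
by rewrite /= nth_rcons size_fps_inv_seq (leq_trans kn nm) IHm.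
Qed.

Fact fps_mulVx : {in fps_unit, left_inverse 1 fps_inv *%R}.
Proof.
move=> f fU; rewrite /= /fps_inv fU; apply/fpsP => k.
rewrite fcoefM fcoef1 big_ord_recr /= subnn nth_rcons size_fps_inv_seq.
rewrite ltnn eqxx mulrAC mulVr // mul1r addrC.
rewrite -addrA -[RHS]addr0; congr (_ + _); rewrite addrC.
apply/eqP; rewrite subr_eq0; apply/eqP/eq_bigr => i _.
by rewrite mulrC -(@nth_fps_inv_seq f k i.+1).
Qed.

Fact fps_unitPl f g : g * f = 1 -> fps_unit f.
Proof.
move=> /fpsP /(_ 0); rewrite fcoefM big_ord_recl big_ord0 addr0 fcoef1 => gf1.
by apply/unitrPr; exists (fcoef g 0); rewrite mulrC.
Qed.

Fact fps_inv_out : {in [predC fps_unit], fps_inv =1 id}.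
Proof. by move=> f /negbTE fU; rewrite /fps_inv fU. Qed.

HB.instance Definition _ := GRing.ComNzRing_hasMulInverse.Build (fps R)
  fps_mulVx fps_unitPl fps_inv_out.

Lemma unit_fpsE f : (f \is a GRing.unit) = (fcoef f 0 \is a GRing.unit).
Proof. by []. Qed.

End FpsUnitRing.

Local Open Scope classical_set_scope.

Section FpsTopology.
Variable R : comNzRingType.
Implicit Types f g : fps R.

HB.instance Definition _ := isPointed.Build (fps R) 0.

Definition fps_nbhs f : set_system (fps R) :=
  filter_from setT
    (fun n => [set g | forall k, (k < n)%N -> fcoef g k = fcoef f k]).

HB.instance Definition _ := hasNbhs.Build (fps R) fps_nbhs.

Fact fps_nbhs_filter f : ProperFilter (nbhs f).
Proof.
apply: filter_from_proper; last by move=> n _; exists f.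
apply: filter_fromT_filter; first by exists 0%N.
move=> m n; exists (maxn m n) => g gf.
by split=> k kn; apply: gf; rewrite leq_max kn ?orbT.
Qed.

Fact fps_nbhs_singleton f (A : set (fps R)) : nbhs f A -> A f.
Proof. by case=> n _; apply. Qed.

Fact fps_nbhs_nbhs f (A : set (fps R)) : nbhs f A -> nbhs f (nbhs^~ A).
Proof.
case=> n _ nA; exists n => // g gf; exists n => // h hg.
by apply: nA => k kn; rewrite hg // gf.
Qed.

HB.instance Definition _ := Nbhs_isNbhsTopological.Build (fps R)
  fps_nbhs_filter fps_nbhs_singleton fps_nbhs_nbhs.

Lemma fps_cvgP (T : Type) (F : set_system T) (FF : Filter F)
    (u : T -> fps R) f :
  u @ F --> f <-> forall k, \forall t \near F, fcoef (u t) k = fcoef f k.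
Proof.
split=> [uf k|uf A [n _ nA]].
  by apply: (uf [set g | fcoef g k = fcoef f k]); exists k.+1 => // g; apply.
have: \forall t \near F, forall k, (k < n)%N -> fcoef (u t) k = fcoef f k.
  elim: n {nA} => [|n IHn]; first by apply: filterS filterT.
  apply: filterS2 IHn (uf n) => t un unn k.
  by rewrite ltnS leq_eqVlt => /predU1P[->|/un].
by apply: filterS => t /nA.
Qed.

Lemma fps_hausdorff : hausdorff_space (fps R).
Proof.
move=> f g fg; apply/fpsP => k.
have nf h : nbhs h [set x | fcoef x k = fcoef h k].
  by exists k.+1 => // x; apply.
by have [x [/= <- <-]] := fg _ _ (nf f) (nf g).
Qed.

End FpsTopology.

Definition qpoch (A : pzRingType) (a q : A) (m : nat) : A :=
  \prod_(j < m) (1 - a * q ^+ j).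

Lemma qpochS (A : pzRingType) (a q : A) m :
  qpoch a q m.+1 = qpoch a q m * (1 - a * q ^+ m).
Proof. by rewrite /qpoch big_ord_recr. Qed.

Definition qpoch_inf (R : comNzRingType) (a q : fps R) : fps R :=
  limn (qpoch a q).

Definition qpochs_inf (R : comNzRingType) (s : seq (fps R)) (q : fps R) :
  fps R := \prod_(a <- s) qpoch_inf a q.

Lemma fcoefMXn_lt (R : comNzRingType) (f q : fps R) j k :
  fcoef q 0 = 0 -> (k < j)%N -> fcoef (f * q ^+ j) k = 0.
Proof.
move=> q0; have qX : forall j k, (k < j)%N -> fcoef (q ^+ j) k = 0.
  elim=> // {}j IHj {}k kj; rewrite exprS fcoefM big1 // => i _.
  have [->|i0] := eqVneq (val i) 0%N; first by rewrite q0 mul0r.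
  rewrite IHj ?mulr0 //; have i_gt0 : (0 < i)%N by rewrite lt0n.
  have ik : (i <= k)%N by rewrite -ltnS.
  apply: (@leq_trans k) => //.
  by rewrite ltn_subrL i_gt0 (leq_trans i_gt0 ik).
move=> kj; rewrite fcoefM big1 // => i _.
by rewrite qX ?mulr0 // (leq_ltn_trans (leq_subr _ _)).
Qed.

(* The infinite products are genuine limits as soon as q(0) = 0.              *)
Lemma cvg_qpoch (R : comNzRingType) (a q : fps R) :
  fcoef q 0 = 0 -> qpoch a q @ \oo --> qpoch_inf a q.
Proof.
move=> q0; apply: (cvgP (Fps (fun k => fcoef (qpoch a q k.+1) k))).
apply/fps_cvgP => k; exists k.+1 => //=; elim=> // n IHn.
rewrite /= leq_eqVlt => /predU1P[-> //|]; rewrite ltnS => kn.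
rewrite -[RHS](IHn kn) qpochS mulrBr mulr1.
by rewrite fcoefD fcoefN mulrA fcoefMXn_lt // subr0.
Qed.

(* Main.v *)
Require Import Defs.
From mathcomp Require Import all_boot all_order all_algebra.
From mathcomp Require Import finmap ring zify.
From mathcomp Require Import boolp classical_sets filter topology.
From mathcomp Require Import showcase.summability.

Set Implicit Arguments.
Unset Strict Implicit.
Unset Printing Implicit Defensive.

Import GRing.Theory.
Local Open Scope classical_set_scope.
Local Open Scope ring_scope.

(** The double sum is a twice iterated Bailey chain with a change of base
    from q to q^2, and the product side is a theta series by the Jacobi triple
    product.

    Put m = n + r. Then 2 n^2 + 4 n r + 3 r^2 = 2 m^2 + r^2, and the left-hand
    side becomes the sum over m of q^(2 m^2) beta_m, where
      beta_m = sum_(r <= m)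
        q^(r^2) / ((-q;q)_m (-q;q)_(m+r) (q;q)_(m-r) (q;q)_r).
    The point is that beta_m is one half of a Bailey pair relative to 1 in
    base q^2, whose other half is the theta series of exponents s(5s+1)/2
    ([bailey_sum_base_change]). Indeed, for a fixed m, the products
    1 / ((q;q)_r (-q;q)_m (-q;q)_(m+r)) are Bailey transforms, in base q, of
    the theta coefficients of exponents s(3s+1)/2 divided by
    (-q;q)_(m-s) (-q;q)_(m+s): this is a limiting case of the terminating
    very-well-poised 6phi5 sum ([bailey_sum_well_poised]). One step of the
    Bailey chain in base q ([bailey_lemma]) multiplies these coefficients by
    q^(s^2) and supplies the factor 1 / ((q;q)_(m-s) (q;q)_(m+s)), which
    merges with the divisor into
    1 / ((q^2;q^2)_(m-s) (q^2;q^2)_(m+s)).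

    A second step of the chain, now in base q^2, multiplies by q^(2 s^2) and
    turns the exponents into s(9s+1)/2 ([bailey_sum_chain]). Letting
    the length of the chain tend to infinity leaves the theta series of
    exponents s(9s+1)/2 over (q^2;q^2)_oo, and the finite form of the triple
    product ([finite_jacobi_triple]) evaluates that series as
    (q^4, q^5, q^9; q^9)_oo.

    All the identities before the passage to the limit are finite ones,
    valid in any commutative ring where the relevant q-factorials are
    invertible. The limits are taken one coefficient at a time, by means of
    congruences modulo a power of the variable. *)

(** * Finite sums and q-factorials *)

Lemma sum_triangle (V : nmodType) (F : nat -> nat -> V) N :
  \sum_(k < N.+1) \sum_(s < k.+1) F k s =
  \sum_(s < N.+1) \sum_(j < (N - s).+1) F (s + j)%N s.
Proof.
elim: N => [|N IHN]; first by rewrite !big_ord1.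
rewrite big_ord_recr IHN [RHS]big_ord_recr /= subnn big_ord1 addn0.
rewrite [X in _ + X]big_ord_recr /= addrA; congr (_ + _).
rewrite -big_split /=; apply: eq_bigr => s _.
have sN : (s <= N)%N by rewrite -ltnS.
by rewrite subSn // [RHS]big_ord_recr /= addnS subnKC.
Qed.

(** The reciprocals of q-factorials are always rewritten from index n to index
    n + 1: in this direction the recurrence involves no division, so that
    the identities below are polynomial ones in the last reciprocals. *)
Lemma qpochV_rec (A : comUnitRingType) (a q : A) n :
  qpoch a q n.+1 \is a GRing.unit ->
  (qpoch a q n)^-1 = (1 - a * q ^+ n) * (qpoch a q n.+1)^-1.
Proof. by rewrite qpochS unitrM => /andP[uq ua]; rewrite invrM // mulVKr. Qed.

Lemma qpoch_factor_unit (A : comUnitRingType) (a q : A) n :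
  qpoch a q n.+1 \is a GRing.unit -> 1 - a * q ^+ n \is a GRing.unit.
Proof. by rewrite qpochS unitrM => /andP[]. Qed.

Lemma qpoch0 (A : comUnitRingType) (a q : A) : qpoch a q 0 = 1.
Proof. by rewrite /qpoch big_ord0. Qed.

(** * Bailey pairs and theta coefficients *)

(** The sequence beta_n of the Bailey pair (alpha, beta) relative to 1. *)
Definition bailey_sum {A : comUnitRingType} (q : A) (alpha : nat -> A) n : A :=
  \sum_(s < n.+1) alpha s * ((qpoch q q (n - s))^-1 * (qpoch q q (n + s))^-1).

(** When x y = Q, this gathers the terms of indices s and - s of the bilateral
    theta series whose term of index s is (-1)^s x^s Q^(s(s-1)/2). *)
Definition theta_coef {A : pzRingType} (Q x y : A) s : A :=
  if s is 0 then 1 else (-1) ^+ s * Q ^+ 'C(s, 2) * (x ^+ s + y ^+ s).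

Lemma theta_coef0 (A : pzRingType) (Q x y : A) : theta_coef Q x y 0 = 1.
Proof. by []. Qed.

Lemma theta_coefS (A : pzRingType) (Q x y : A) s :
  theta_coef Q x y s.+1 =
  (-1) ^+ s.+1 * Q ^+ 'C(s.+1, 2) * (x ^+ s.+1 + y ^+ s.+1).
Proof. by []. Qed.

Arguments theta_coef : simpl never.

(** The effect of one step of the Bailey chain on a theta series: it only
    changes the parameters, and preserves the relation x y = Q. *)
Lemma theta_coef_shift {A : comUnitRingType} (Q x y u : A) s :
  u ^+ (s ^ 2) * theta_coef Q x y s =
  theta_coef (u ^+ 2 * Q) (u * x) (u * y) s.
Proof.
case: s => [|s]; rewrite ?theta_coef0 ?theta_coefS ?mulr1 //.
rewrite (exprMn _ (u ^+ 2) Q) (exprMn _ u x) (exprMn _ u y) -exprM.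
have -> : (s.+1 ^ 2 = 2 * 'C(s.+1, 2) + s.+1)%N.
  by rewrite bin2 -mulnn mul2n halfK oddM oddS andNb subn0 mulSn /= mulnC addnC.
by rewrite exprD; ring.
Qed.

Section BaileyChain.
Variables (A : comUnitRingType) (q : A).
Hypothesis q_unit : forall n, qpoch q q n \is a GRing.unit.

Let E n := (qpoch q q n)^-1.

Let E_rec n : E n = (1 - q * q ^+ n) * E n.+1.
Proof. exact: qpochV_rec. Qed.

Let E0 : E 0 = 1. Proof. by rewrite /E qpoch0 invr1. Qed.

(** A q-Chu-Vandermonde sum. For the step from M to M + 1, the factor
    1 - q^(M+1) splits as q^j (1 - q^(M+1-j)) + (1 - q^j) (the q-Pascal rule);
    after a shift of j in the second part, the two parts recombine into the
    sum of parameters M and m + 1. *)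
Lemma q_vandermonde M m :
  \sum_(j < M.+1) q ^+ (j * (j + m)) * (E (M - j) * (E j * E (j + m))) =
  E M * E (M + m).
Proof.
elim: M m => [|M IHM] m.
  by rewrite big_ord1 /= mul0n mul1r !E0 mul1r.
apply: (mulrI (qpoch_factor_unit (q_unit M.+1))).
rewrite mulrA -E_rec addSnnS -IHM mulr_sumr.
pose F1 j := q ^+ (j * (j + m) + j) * (1 - q ^+ (M.+1 - j)) *
             (E (M.+1 - j) * (E j * E (j + m))).
pose F2 j := q ^+ (j * (j + m)) * (1 - q ^+ j) *
             (E (M.+1 - j) * (E j * E (j + m))).
transitivity (\sum_(j < M.+2) F1 j + \sum_(j < M.+2) F2 j).
  rewrite -big_split; apply: eq_bigr => j _; rewrite /F1 /F2 /= -exprS.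
  have jM : (j <= M.+1)%N by rewrite -ltnS.
  by rewrite -{1}(subnKC jM) !exprD; ring.
(* The term j = M + 1 of F1 and the term j = 0 of F2 vanish. *)
rewrite [X in X + _]big_ord_recr [X in _ + X]big_ord_recl /=.
rewrite {2}/F1 {1}/F2 subnn expr0 subrr.
rewrite !(mulr0, mul0r) addr0 add0r -big_split; apply: eq_bigr => j _ /=.
have jM : (j <= M)%N by rewrite -ltnS.
rewrite /F1 /F2 /bump /= add1n subSS addSn subSn //.
rewrite (E_rec (M - j)) (E_rec j) (E_rec (j + m)) addnS -!exprS.
have -> : (j.+1 * (j + m).+1 = j * (j + m).+1 + (j + m).+1)%N.
  by rewrite mulSn addnC.
by rewrite mulnS !exprD; ring.
Qed.

(** One step of the Bailey chain: exchanging the two summations leaves, for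
    each s, the q-Chu-Vandermonde sum of parameters N - s and 2 s. *)
Lemma bailey_lemma (alpha : nat -> A) N :
  \sum_(k < N.+1) q ^+ (k ^ 2) * (bailey_sum q alpha k * E (N - k)) =
  bailey_sum q (fun s => q ^+ (s ^ 2) * alpha s) N.
Proof.
pose F k s := q ^+ (k ^ 2) * (alpha s * (E (k - s) * E (k + s)) * E (N - k)).
transitivity (\sum_(k < N.+1) \sum_(s < k.+1) F k s).
  by apply: eq_bigr => k _; rewrite /bailey_sum mulr_suml mulr_sumr.
rewrite sum_triangle; apply: eq_bigr => s _.
have sN : (s <= N)%N by rewrite -ltnS.
have := q_vandermonde (N - s) (2 * s); rewrite mul2n -addnn addnA subnK //.
rewrite -/(E _) -/(E _) => <-.
rewrite mulr_sumr; apply: eq_bigr => j _ /=; rewrite /F.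
have -> : ((s + j) ^ 2 = s ^ 2 + j * (j + (s + s)))%N by ring.
rewrite addKn subnDA exprD (_ : s + j + s = j + (s + s))%N; last by ring.
by ring.
Qed.

Section Shifted.
Variable c : A.
Hypothesis cq_unit : forall n, qpoch (c * q) q n \is a GRing.unit.

Let H n := (qpoch (c * q) q n)^-1.

Let H_rec n : H n = (1 - c * q * q ^+ n) * H n.+1.
Proof. exact: qpochV_rec. Qed.

(** A limiting case of the terminating very-well-poised 6phi5 sum. The bound
    k <= N keeps every index N - s meaningful. The induction on k is a
    creative telescoping: the difference of the summands for k + 1 and k,
    both normalized by the value of the sum, has partial sums in closed
    form. *)
Lemma bailey_sum_well_poised N k : (k <= N)%N ->
  bailey_sum q
    (fun s => theta_coef (q ^+ 3) q (q ^+ 2) s * (H (N - s) * H (N + s))) k =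
  H N * (E k * H (N + k)).
Proof.
set al := (fun s => _ : A).
elim: k => [|k IHk] kN.
  rewrite /bailey_sum big_ord1 /al theta_coef0 /= subn0 addn0 -/(E 0) E0.
  by ring.
pose K := k.+1; rewrite -/K in kN *.
pose X := (1 - q ^+ K) * (1 - c * q ^+ (N + K)).
(* X is the ratio of the right-hand sides for k and for K, and g t is the sum
   of the first t + 1 differences; the factor 1 - q^(K-t) makes g K vanish. *)
pose g t := (-1) ^+ t * q ^+ (K + 3 * 'C(t.+1, 2)) *
  ((1 - c * q ^+ (N - t)) * (1 - q ^+ (K - t)) *
   (H (N - t) * H (N + t) * (E (K - t) * E (K + t)))).
have gE t : (t <= K)%N -> \sum_(s < t.+1)
    al s * ((X - (1 - q ^+ (K - s)) * (1 - q ^+ (K + s))) *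
            (E (K - s) * E (K + s))) = g t.
  elim: t => [|t IHt] tK.
    by rewrite big_ord1 /g /al /X theta_coef0 /= !subn0 !addn0 exprD; ring.
  rewrite big_ord_recr /= IHt ?(ltnW tK) //.
  rewrite /al /g /X theta_coefS.
  (* All subtractions disappear once K and N are written from t + 1. *)
  have [d ->] : exists d, K = (d + t.+1)%N by exists (K - t.+1)%N; rewrite subnK.
  have [e ->] : exists e, N = (e + t.+1)%N.
    by exists (N - t.+1)%N; rewrite subnK // (leq_trans tK).
  rewrite !addnK !addnS -!addSn !addnK !addSn.
  rewrite (H_rec e) (E_rec d) (H_rec (e + t + t).+1) (E_rec (d + t + t).+1).
  rewrite (binS t.+1 1) (binS t 1) !bin1 !mulnDr -!exprM.
  rewrite !(exprD, exprS, mulSn, mulnS, mul0n, muln0, addnS, addSn, addn0).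
  by ring.
have XB : X * bailey_sum q al K = bailey_sum q al k.
  apply/eqP; rewrite -subr_eq0; apply/eqP.
  transitivity (g K); last by rewrite /g subnn expr0 subrr !(mul0r, mulr0).
  have -> : bailey_sum q al k = \sum_(s < K.+1) al s *
      ((1 - q ^+ (K - s)) * (1 - q ^+ (K + s)) * (E (K - s) * E (K + s))).
    (* The term s = K added here is zero, because of 1 - q^(K-s). *)
    rewrite big_ord_recr /= subnn expr0 subrr !mul0r mulr0 addr0.
    apply: eq_bigr => s _; have sk : (s <= k)%N by rewrite -ltnS.
    rewrite /K subSn // addSn -/(E _) -/(E _) (E_rec (k - s)) (E_rec (k + s)).
    by rewrite !exprS; ring.
  rewrite -gE // mulr_sumr -sumrB; apply: eq_bigr => s _.
  by rewrite -/(E _) -/(E _); ring.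
have XU : X \is a GRing.unit.
  rewrite unitrM; apply/andP; split.
    by have := qpoch_factor_unit (q_unit K); rewrite exprS.
  by have := qpoch_factor_unit (cq_unit (N + k).+1); rewrite addnS exprS mulrA.
apply: (mulrI XU); rewrite XB IHk ?(ltnW kN) //.
by rewrite /X /K addnS (E_rec k) (H_rec (N + k)) !exprS; ring.
Qed.

End Shifted.
End BaileyChain.

(** The finite form of the Jacobi triple product, read as a Bailey pair in base
    Q. Again the difference between the sums for M + 1 and M, suitably
    normalized, telescopes. *)
Lemma finite_jacobi_triple (A : comUnitRingType) (Q x y : A) M :
  (forall n, qpoch Q Q n \is a GRing.unit) -> x * y = Q ->
  bailey_sum Q (theta_coef Q x y) M =
  qpoch x Q M * qpoch y Q M * (qpoch Q Q (M + M))^-1.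
Proof.
move=> Q_unit xyQ; pose E n := (qpoch Q Q n)^-1.
have E_rec n : E n = (1 - Q * Q ^+ n) * E n.+1 by apply: qpochV_rec.
elim: M => [|M IHM].
  rewrite /bailey_sum big_ord1 theta_coef0 /= subn0 addn0 !qpoch0.
  by rewrite invr1 !mulr1.
set al := theta_coef Q x y in IHM *.
pose K := M.+1.
(* The right-hand sides for K and M are in the ratio Y / X; g t is the sum of
   the first t + 1 terms of X times the sum for K minus Y times the sum for
   M. The difference Q^(t+1) - Q^K stands for Q^(t+1) (1 - Q^(M-t)), without
   a subtraction that would be truncated at t = K. *)
pose X := (1 - Q ^+ (M + M).+1) * (1 - Q ^+ (M + M).+2).
pose Y := (1 - x * Q ^+ M) * (1 - y * Q ^+ M).
pose g t := (-1) ^+ t * Q ^+ ('C(t, 2) + M) * (1 - Q ^+ (K - t)) *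
  ((x ^+ t.+1 + y ^+ t.+1) * (1 - Q ^+ (K + t)) +
   (x ^+ t + y ^+ t) * (Q ^+ t.+1 - Q ^+ K)) * (E (K - t)%N * E (K + t)%N).
have gE t : (t <= K)%N -> \sum_(s < t.+1)
    al s * ((X - Y * ((1 - Q ^+ (K - s)) * (1 - Q ^+ (K + s)))) *
            (E (K - s)%N * E (K + s)%N)) = g t.
  elim: t => [|t IHt] tK.
    rewrite big_ord1 /al theta_coef0 /g /X /Y /K /= !subn0 addn0 bin0n add0n.
    by rewrite -xyQ !(exprS, exprD) !expr0; ring.
  rewrite big_ord_recr /= IHt ?(ltnW tK) //.
  rewrite /al /g /X /Y theta_coefS.
  have [d Kd] : exists d, K = (d + t.+1)%N by exists (K - t.+1)%N; rewrite subnK.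
  have -> : M = (d + t)%N by apply/eqP; rewrite -eqSS -addnS -Kd.
  rewrite Kd !addnK !addnS -!addSn !addnK !addSn.
  rewrite (E_rec d) (E_rec (d + t + t).+1%N).
  rewrite (binS t 1) bin1 -xyQ.
  rewrite !(exprD, exprS, addnS, addSn, addn0).
  by ring.
have XY : X * bailey_sum Q al K = Y * bailey_sum Q al M.
  apply/eqP; rewrite -subr_eq0; apply/eqP.
  transitivity (g K); last by rewrite /g subnn expr0 subrr !(mul0r, mulr0).
  have -> : bailey_sum Q al M = \sum_(s < K.+1) al s *
      ((1 - Q ^+ (K - s)) * (1 - Q ^+ (K + s)) * (E (K - s)%N * E (K + s)%N)).
    rewrite big_ord_recr /= subnn expr0 subrr !mul0r mulr0 addr0.
    apply: eq_bigr => s _; have sM : (s <= M)%N by rewrite -ltnS.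
    rewrite /K subSn // addSn -/(E _) -/(E _).
    by rewrite (E_rec (M - s)%N) (E_rec (M + s)%N) !exprS; ring.
  rewrite -gE // !mulr_sumr -sumrB; apply: eq_bigr => s _.
  by rewrite -/(E _) -/(E _); ring.
have XU : X \is a GRing.unit.
  rewrite unitrM !exprS -!exprS exprS [_ ^+ _.+2]exprS.
  by rewrite !qpoch_factor_unit.
apply: (mulrI XU); rewrite XY IHM (qpochS x) (qpochS y) addnS addSn.
rewrite -/(E _) -/(E _).
by rewrite (E_rec (M + M)%N) (E_rec (M + M).+1%N) /X /Y !exprS; ring.
Qed.

(** * The change of base from q to q^2 *)

Section BaseChange.
Variables (A : comUnitRingType) (q : A).
Hypothesis q_unit : forall n, qpoch q q n \is a GRing.unit.
Hypothesis Nq_unit : forall n, qpoch (- q) q n \is a GRing.unit.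

Lemma qpoch_sqr n : qpoch (q ^+ 2) (q ^+ 2) n = qpoch q q n * qpoch (- q) q n.
Proof.
rewrite /qpoch -big_split; apply: eq_bigr => j _ /=.
by rewrite -!exprM mulnC exprM; ring.
Qed.

Lemma qpoch_sqrV n :
  (qpoch (q ^+ 2) (q ^+ 2) n)^-1 = (qpoch q q n)^-1 * (qpoch (- q) q n)^-1.
Proof. by rewrite qpoch_sqr invrM // mulrC. Qed.

(** The coefficients fed to the Bailey chain in base q depend on N through the
    divisor (-q;q)_(N-s) (-q;q)_(N+s), which is exactly what turns
    (q;q)_(N-s) (q;q)_(N+s) into q^2-factorials. *)
Lemma bailey_sum_base_change N :
  bailey_sum (q ^+ 2) (theta_coef (q ^+ 5) (q ^+ 2) (q ^+ 3)) N =
  \sum_(r < N.+1) q ^+ (r ^ 2) / (qpoch (- q) q N *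
    qpoch (- q) q (N + r) * qpoch q q (N - r) * qpoch q q r).
Proof.
have cq_unit n : qpoch (-1 * q) q n \is a GRing.unit by rewrite mulN1r.
have := @bailey_lemma _ q q_unit (fun s => theta_coef (q ^+ 3) q (q ^+ 2) s *
  ((qpoch (-1 * q) q (N - s))^-1 * (qpoch (-1 * q) q (N + s))^-1)) N.
rewrite mulN1r => BL; transitivity (bailey_sum q (fun s => q ^+ (s ^ 2) *
   (theta_coef (q ^+ 3) q (q ^+ 2) s *
   ((qpoch (- q) q (N - s))^-1 * (qpoch (- q) q (N + s))^-1))) N).
  apply: eq_bigr => s _; rewrite /= !qpoch_sqrV.
  have -> : theta_coef (q ^+ 5) (q ^+ 2) (q ^+ 3) s =
            q ^+ (s ^ 2) * theta_coef (q ^+ 3) q (q ^+ 2) s.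
    by rewrite theta_coef_shift -exprD -!exprS.
  by ring.
rewrite -BL; apply: eq_bigr => r _.
have rN : (r <= N)%N by rewrite -ltnS.
have := @bailey_sum_well_poised _ q q_unit (-1) cq_unit N r rN.
rewrite mulN1r => ->.
by rewrite !invrM ?unitrM ?q_unit ?Nq_unit //; ring.
Qed.

(** A finite version of the theorem: the inner fractions are the terms of the
    double series, with k = n + r. *)
Lemma bailey_sum_chain N :
  \sum_(k < N.+1) \sum_(r < k.+1) (q ^+ (2 * k ^ 2 + r ^ 2) /
    (qpoch (- q) q k * qpoch (- q) q (k + r) * qpoch q q (k - r) * qpoch q q r)
    / qpoch (q ^+ 2) (q ^+ 2) (N - k)) =
  bailey_sum (q ^+ 2) (theta_coef (q ^+ 9) (q ^+ 4) (q ^+ 5)) N.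
Proof.
have p_unit n : qpoch (q ^+ 2) (q ^+ 2) n \is a GRing.unit.
  by rewrite qpoch_sqr unitrM q_unit Nq_unit.
transitivity (bailey_sum (q ^+ 2) (fun s => q ^+ 2 ^+ (s ^ 2) *
  theta_coef (q ^+ 5) (q ^+ 2) (q ^+ 3) s) N); last first.
  by apply: eq_bigr => s _; rewrite /= theta_coef_shift -!exprM -!exprD.
rewrite -bailey_lemma //; apply: eq_bigr => k _.
rewrite bailey_sum_base_change mulr_suml mulr_sumr; apply: eq_bigr => r _.
by rewrite exprD exprM !mulrA.
Qed.

End BaseChange.

(** * Congruences between power series, and limits *)

Section Congruence.
Variable R : comUnitRingType.
Implicit Types f g h p q x y z : fps R.

Definition eqmodX k f g := forall j, (j < k)%N -> fcoef f j = fcoef g j.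

Lemma eqmodX_sym k f g : eqmodX k f g -> eqmodX k g f.
Proof. by move=> fg j jk; rewrite fg. Qed.

Lemma eqmodX_trans k f g h : eqmodX k f g -> eqmodX k g h -> eqmodX k f h.
Proof. by move=> fg gh j jk; rewrite fg // gh. Qed.

Lemma eqmodX_mul k f f' g g' :
  eqmodX k f f' -> eqmodX k g g' -> eqmodX k (f * g) (f' * g').
Proof.
move=> ff' gg' j jk; rewrite !fcoefM; apply: eq_bigr => i _.
rewrite ff' ?gg' //; first by rewrite (leq_ltn_trans (leq_subr _ _)).
by apply: leq_ltn_trans jk; rewrite -ltnS.
Qed.

Lemma eqmodX_mul0 k f g : eqmodX k f 0 -> eqmodX k (f * g) 0.
Proof. by move=> f0; rewrite -(mul0r g); apply: eqmodX_mul. Qed.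

Lemma fcoef_sum I (r : seq I) (P : pred I) (F : I -> fps R) j :
  fcoef (\sum_(i <- r | P i) F i) j = \sum_(i <- r | P i) fcoef (F i) j.
Proof. by apply: (big_morph (fun f => fcoef f j)). Qed.

Lemma eqmodX_sum k I (r : seq I) (P : pred I) (F G : I -> fps R) :
  (forall i, P i -> eqmodX k (F i) (G i)) ->
  eqmodX k (\sum_(i <- r | P i) F i) (\sum_(i <- r | P i) G i).
Proof. by move=> FG j jk; rewrite !fcoef_sum; apply: eq_bigr => i /FG ->. Qed.

Lemma eqmodX_inv k f g : f \is a GRing.unit -> g \is a GRing.unit ->
  eqmodX k f g -> eqmodX k f^-1 g^-1.
Proof.
move=> fU gU fg; have : eqmodX k (f^-1 * (g * g^-1)) (f^-1 * (f * g^-1)).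
  by do 2![apply: eqmodX_mul => //]; apply: eqmodX_sym.
by rewrite mulrV // mulKr // mulr1.
Qed.

Lemma eqmodX_expM0 k n f : (k <= n)%N -> eqmodX k (fpsX R ^+ n * f) 0.
Proof.
by move=> kn j jk; rewrite mulrC fcoefMXn_lt //; apply: leq_trans kn.
Qed.

Lemma fcoef0M f g : fcoef (f * g) 0 = fcoef f 0 * fcoef g 0.
Proof. by rewrite fcoefM big_ord1. Qed.

Lemma fcoef0_qpoch a q n : fcoef a 0 = 0 -> fcoef (qpoch a q n) 0 = 1.
Proof.
move=> a0; elim: n => [|n IHn]; first by rewrite qpoch0.
by rewrite qpochS fcoef0M IHn mul1r fcoefD fcoefN fcoef0M a0 mul0r subr0.
Qed.

Lemma qpoch_unit a q n : fcoef a 0 = 0 -> qpoch a q n \is a GRing.unit.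
Proof. by move=> a0; rewrite unit_fpsE fcoef0_qpoch // unitr1. Qed.

Lemma qpoch_inf_eqmodX a q k n : fcoef q 0 = 0 -> (k <= n)%N ->
  eqmodX k (qpoch a q n) (qpoch_inf a q).
Proof.
move=> q0 kn j jk.
have stable m : (j < m)%N -> fcoef (qpoch a q m) j = fcoef (qpoch a q n) j.
  have step i : (j < i)%N -> fcoef (qpoch a q i.+1) j = fcoef (qpoch a q i) j.
    move=> ji; rewrite qpochS mulrBr mulr1 fcoefD fcoefN mulrA.
    by rewrite fcoefMXn_lt // subr0.
  have const i : (j < i)%N -> fcoef (qpoch a q i) j = fcoef (qpoch a q j.+1) j.
    elim: i => // i IHi; rewrite ltnS leq_eqVlt => /predU1P[->//|ji].
    by rewrite step // IHi.
  by move=> jm; rewrite !const // (leq_trans jk).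
have [n0 _ lim_n0] := (fps_cvgP _ _ _).1 (@cvg_qpoch _ a q q0) j.
rewrite -(lim_n0 (maxn n0 j.+1)) /= ?leq_maxl // [RHS]stable //.
by rewrite leq_max ltnSn orbT.
Qed.

Lemma qpoch_inf_unit a q : fcoef a 0 = 0 -> fcoef q 0 = 0 ->
  qpoch_inf a q \is a GRing.unit.
Proof.
move=> a0 q0; rewrite unit_fpsE.
by rewrite -(qpoch_inf_eqmodX a q0 (leqnn 1)) // fcoef0_qpoch // unitr1.
Qed.

Lemma qpochV_eqmodX p k n : fcoef p 0 = 0 -> (k <= n)%N ->
  eqmodX k (qpoch p p n)^-1 (qpoch_inf p p)^-1.
Proof.
move=> p0 kn; apply: eqmodX_inv; first exact: qpoch_unit.
  exact: qpoch_inf_unit.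
exact: qpoch_inf_eqmodX.
Qed.

(** The limit of a Bailey sum. At the index k + k, the coefficients with s < k
    have k <= k + k - s, so both q-factorials already agree with their limits
    modulo the k-th power of the variable, while the others contribute
    nothing. *)
Lemma bailey_sum_eqmodX p alpha k : fcoef p 0 = 0 ->
  (forall s, (k <= s)%N -> eqmodX k (alpha s) 0) ->
  eqmodX k (bailey_sum p alpha (k + k))
    ((\sum_(s < (k + k).+1) alpha s) / qpoch_inf p p / qpoch_inf p p).
Proof.
move=> p0 alpha0; rewrite -mulrA mulr_suml; apply: eqmodX_sum => s _.
have [ks|sk] := leqP k s.
  apply: (@eqmodX_trans _ _ 0); last apply: eqmodX_sym.
    exact: eqmodX_mul0 (alpha0 _ ks).
  exact: eqmodX_mul0 (alpha0 _ ks).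
apply: eqmodX_mul => //.
apply: eqmodX_mul; apply: qpochV_eqmodX => //.
  by rewrite -addnBA ?leq_addr // ltnW.
by rewrite -addnA leq_addr.
Qed.

Lemma qpochs_inf3 x y z p :
  qpochs_inf [:: x; y; z] p =
  qpoch_inf x p * qpoch_inf y p * qpoch_inf z p.
Proof.
rewrite /qpochs_inf !big_cons big_nil.
(* Left visible, the three limits would be unfolded by unification. *)
move: (qpoch_inf x p) (qpoch_inf y p) (qpoch_inf z p) => a b c.
by rewrite mulr1 mulrA.
Qed.

(** The Jacobi triple product, as a congruence: multiply the limit of its
    finite form by the square of (Q;Q)_oo. *)
Lemma jacobi_triple_eqmodX (Q x y : fps R) k :
  x * y = Q -> fcoef x 0 = 0 -> fcoef y 0 = 0 ->
  (forall s, (k <= s)%N -> eqmodX k (theta_coef Q x y s) 0) ->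
  eqmodX k (\sum_(s < (k + k).+1) theta_coef Q x y s)
           (qpochs_inf [:: x; y; Q] Q).
Proof.
rewrite qpochs_inf3 => xyQ x0 y0 theta0.
have Q0 : fcoef Q 0 = 0 by rewrite -xyQ fcoef0M x0 mul0r.
have QU : qpoch_inf Q Q \is a GRing.unit by apply: qpoch_inf_unit.
have := bailey_sum_eqmodX Q0 theta0; rewrite finite_jacobi_triple //; last first.
  by move=> n; apply: qpoch_unit.
set S := \sum_(s < _) _ => JT.
have -> : S = S / qpoch_inf Q Q / qpoch_inf Q Q *
              (qpoch_inf Q Q * qpoch_inf Q Q).
  by rewrite mulrA !divrK.
apply: (@eqmodX_trans _ _ (qpoch_inf x Q * qpoch_inf y Q / qpoch_inf Q Q *
    (qpoch_inf Q Q * qpoch_inf Q Q))); last by rewrite mulrA divrK.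
apply: eqmodX_mul => //; apply: eqmodX_trans (eqmodX_sym JT) _.
apply: eqmodX_mul; last by apply: qpochV_eqmodX => //; rewrite -addnA leq_addr.
by apply: eqmodX_mul; apply: qpoch_inf_eqmodX => //; apply: leq_addr.
Qed.

End Congruence.

Lemma theta_coef_eqmodX (R : comUnitRingType) (a b c k s : nat) :
  (0 < b)%N -> (0 < c)%N -> (k <= s)%N ->
  eqmodX k (theta_coef (fpsX R ^+ a) (fpsX R ^+ b) (fpsX R ^+ c) s) 0.
Proof.
move=> b0 c0; case: s => [|s] ks; first by move: ks; rewrite leqn0 => /eqP->.
move=> j jk; rewrite theta_coefS mulrDr fcoefD mulrC -exprM.
rewrite (eqmodX_expM0 (k := k)) ?(leq_trans ks) ?leq_pmull // mulrC -exprM.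
by rewrite (eqmodX_expM0 (k := k)) ?(leq_trans ks) ?leq_pmull // addr0.
Qed.

(** A double series whose terms have order at least max(n, r) is summable, and
    the coefficient of index j < k of its sum can be read off the square
    n, r < k. *)
Lemma partial_sum_cvg (R : comNzRingType) (F : nat * nat -> fps R) f :
  (forall k n r, (k <= n)%N || (k <= r)%N -> forall j, (j < k)%N ->
     fcoef (F (n, r)) j = 0) ->
  (forall k j, (j < k)%N ->
     \sum_(n < k) \sum_(r < k) fcoef (F (n : nat, r : nat)) j = fcoef f j) ->
  partial_sum F @ totally --> f.
Proof.
move=> F0 Ff; apply/(@fps_cvgP _ _ _ totally_filter) => j.
set k := j.+1; pose s := [seq (n, r) | n <- iota 0 k, r <- iota 0 k].
have s_uniq : uniq s.
  by apply: allpairs_uniq; rewrite ?iota_uniq // => -[? ?] [].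
move: (seq_fset tt s) (seq_fsetE tt s) (seq_fset_perm tt s) => S SE S_perm.
exists S => // B /= sB.
rewrite /partial_sum (big_morph (fun g => fcoef g j) (id1 := 0) (op1 := +%R)) //.
rewrite -(Ff k j) // -(big_seq_fsetE _ B xpredT (fun i => fcoef (F i) j)) /=.
rewrite -(big_fset_incl _ sB); last first.
  move=> [n r] _; rewrite SE => nr; apply: (F0 k) => //.
  apply: contraR nr; rewrite negb_or -!ltnNge => /andP[nk rk].
  by apply/allpairsP; exists (n, r); split=> //; rewrite mem_iota.
rewrite (perm_big s); last by rewrite undup_id in S_perm.
rewrite big_allpairs -[iota 0 k]/(index_iota 0 k) big_mkord.
by apply: eq_bigr => n _; rewrite big_mkord.
Qed.

(** * The identity *)

Theorem mainTheorem1 :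
  let q : fps int := fpsX int in
  partial_sum (fun nr : nat * nat =>
      let: (n, r) := nr in
      q ^+ (2 * n ^ 2 + 3 * r ^ 2 + 4 * n * r)%N /
      (qpoch (- q) q (n + r)%N * qpoch (- q) q (n + 2 * r)%N *
       qpoch q q n * qpoch q q r))
    @ totally -->
  qpochs_inf [:: q ^+ 4; q ^+ 5; q ^+ 9] (q ^+ 9) / qpoch_inf (q ^+ 2) (q ^+ 2).
Proof.
move=> q; set F := fun nr : nat * nat => _.
have q0 : fcoef q 0 = 0 by [].
have X0 n : (0 < n)%N -> fcoef (q ^+ n) 0 = 0.
  by case: n => // n _; rewrite fcoefX.
have F_small k n r : (k <= n)%N || (k <= r)%N -> eqmodX k (F (n, r)) 0.
  by move=> knr; apply: eqmodX_expM0; nia.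
(* The terms in the variables m = n + r and r. *)
have FE m r : (r <= m)%N -> F ((m - r)%N, r) = q ^+ (2 * m ^ 2 + r ^ 2) /
    (qpoch (- q) q m * qpoch (- q) q (m + r) * qpoch q q (m - r) * qpoch q q r).
  move=> rm; rewrite /F subnK //.
  by congr (q ^+ _ / (_ * qpoch _ _ _ * _ * _)); nia.
clearbody F; apply: partial_sum_cvg => [//|k j jk].
pose p := q ^+ 2; pose P := qpoch_inf p p; pose N := (k + k)%N.
have p0 : fcoef p 0 = 0 by apply: X0.
have PU : P \is a GRing.unit by apply: qpoch_inf_unit.
have q_unit n : qpoch q q n \is a GRing.unit by apply: qpoch_unit.
have Nq_unit n : qpoch (- q) q n \is a GRing.unit.
  by apply: qpoch_unit; rewrite fcoefN q0 oppr0.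
pose theta s := theta_coef (q ^+ 9) (q ^+ 4) (q ^+ 5) s.
have theta_small s : (k <= s)%N -> eqmodX k (theta s) 0.
  exact: theta_coef_eqmodX.
pose S := \sum_(m < N.+1) \sum_(r < m.+1) F ((m - r)%N, r : nat).
(* The triangle n + r <= 2 k contains the square n, r < k, and the terms off
   the square have no coefficient of index j. *)
have box : \sum_(n < k) \sum_(r < k) fcoef (F (n : nat, r : nat)) j = fcoef S j.
  rewrite /S (sum_triangle (fun m r => F ((m - r)%N, r))) exchange_big /=.
  rewrite fcoef_sum -addnS big_split_ord /= [X in _ + X]big1 ?addr0; last first.
    move=> r _; rewrite fcoef_sum big1 // => n _.
    by rewrite (F_small k) // leq_addr orbT.
  apply: eq_bigr => r _; rewrite fcoef_sum.
  have -> : (N - r).+1 = (k + (k - r).+1)%N by rewrite /N; have := ltn_ord r; lia.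
  rewrite big_split_ord /= [X in _ + X]big1 ?addr0.
    by apply: eq_bigr => n _; rewrite addKn.
  by move=> n _; rewrite addKn (F_small k) // leq_addr.
rewrite box {box}; suff: eqmodX k (S / P * P)
    (qpochs_inf [:: q ^+ 4; q ^+ 5; q ^+ 9] (q ^+ 9) / P).
  by rewrite divrK //; apply.
(* The terms with m >= k vanish modulo the k-th power of q, and the others have
   N - m >= k, so that 1 / P may be replaced by the reciprocal of
   (p;p)_(N-m). *)
have SP : eqmodX k (S / P) (bailey_sum p theta N).
  rewrite -bailey_sum_chain // /S mulr_suml; apply: eqmodX_sum => m _.
  rewrite mulr_suml; apply: eqmodX_sum => r _.
  rewrite FE; last by rewrite -ltnS.
  have [km|mk] := leqP k m.
    apply: (@eqmodX_trans _ _ _ 0); last apply: eqmodX_sym.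
      by apply/eqmodX_mul0/eqmodX_expM0; nia.
    by apply/eqmodX_mul0/eqmodX_expM0; nia.
  apply: eqmodX_mul => //; apply/eqmodX_sym/qpochV_eqmodX => //.
  by rewrite -addnBA ?leq_addr // ltnW.
set J := qpochs_inf _ _; rewrite -(divrK PU (J / P)).
apply: eqmodX_mul => //; apply: eqmodX_trans SP _.
apply: (eqmodX_trans (bailey_sum_eqmodX p0 theta_small)).
do 2![apply: eqmodX_mul => //]; apply: jacobi_triple_eqmodX => //; try exact: X0.
by rewrite -exprD.
Qed.
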